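(* For every integer $t\geq 1$, \[ rx_3(K_{2,t})=\begin{cases} 2, & \text{if } t=1,2;\\ 3, & \text{if } t=3,4;\\ 4, & \text{if } 5\leq t\leq 8;\\ 5, & \text{if } 9\leq t\leq 20;\\ k, & \text{if } (k-1)(k-2)+1\leq t\leq k(k-1) \text{ for an integer } k\geq 6. \end{cases} \]
   Context: All graphs are simple, finite, undirected. An edge coloring of a graph $G$ is any assignment of colors to the edges (adjacent edges may receive the same color). A tree $T$ in an edge-colored graph is a rainbow tree if no two edges of $T$ have the same color. For $S\subseteq V(G)$, an $S$-tree is a subtree of $G$ containing all vertices of $S$. For an integer $k\ge 2$, a $k$-rainbow coloring of $G$ is an edge coloring such that for every set $S$ of $k$ vertices of $G$ there is a rainbow $S$-tree in $G$. The $k$-rainbow index $rx_k(G)$ is the minimum number of colors in a $k$-rainbow coloring of $G$. $K_{2,t}$ denotes the complete bipartite graph with parts of sizes $2$ and $t$. *)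

(* Defs.v *)
From mathcomp Require Import all_boot.
Set Implicit Arguments. Unset Strict Implicit. Unset Printing Implicit Defensive.

(* A simple graph on a finite vertex type T is given by an adjacency relation
   adj (symmetric, irreflexive).  Edges are 2-element vertex sets. *)
Definition edges (T : finType) (adj : rel T) : {set {set T}} :=
  [set e : {set T} | [exists x : T, exists y : T, adj x y && (e == [set x; y])]].

Definition is_tree (T : finType) (V : {set T}) (E : {set {set T}}) : Prop :=
  [/\ V != set0,
      (forall e : {set T}, e \in E -> e \subset V),
      #|E| = (#|V| - 1)%N
    & {in V &, forall x y, connect (fun u v => [set u; v] \in E) x y}].

(* An edge coloring (values on non-edges are irrelevant) is a k-rainbow
   coloring if every k-set S of vertices lies in a rainbow subtree of G. *)
Definition k_rainbow_coloring (T : finType) (adj : rel T) (k : nat)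
    (C : Type) (col : {set T} -> C) : Prop :=
  forall S : {set T}, #|S| = k ->
    exists (V : {set T}) (E : {set {set T}}),
      [/\ S \subset V, E \subset edges adj, is_tree V E
        & {in E &, injective col}].

Definition rainbow_index_is (T : finType) (adj : rel T) (k n : nat) : Prop :=
  (exists col : {set T} -> 'I_n, k_rainbow_coloring adj k col) /\
  (forall m (col : {set T} -> 'I_m), k_rainbow_coloring adj k col -> n <= m).

Definition K2t_adj (t : nat) : rel ('I_2 + 'I_t)%type :=
  fun x y => match x, y with
             | inl _, inr _ | inr _, inl _ => true
             | _, _ => false
             end.
Arguments K2t_adj t : clear implicits.

(* Main.v *)
(** Give each right vertex the pair of colors of its two edges.  Any three right
    vertices have incident edges of three distinct colors in a rainbow tree, so
    at most two right vertices have their colors inside a given 2-set of colors;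
    summing over the 2-sets gives t <= n (n - 1).  With n <= 4 colors a rainbow
    tree has at most five vertices, so whether a triple is covered depends on its
    own color pairs only, and a finite search gives t <= 4 for n = 3 and t <= 8
    for n = 4.  Conversely, for n >= 5 it suffices to use distinct pairs of
    distinct colors realizing every 2-set of colors: three such pairs have
    distinct representatives, and a vertex colored by two of the remaining colors
    joins the two hubs.  The values t <= 9 are settled by explicit colorings. *)

Require Import Defs.
From mathcomp Require Import all_boot zify.
Set Implicit Arguments. Unset Strict Implicit. Unset Printing Implicit Defensive.

(** * Rainbow trees grown leaf by leaf *)

Definition rtree (T : finType) (adj : rel T) (C : eqType) (col : {set T} -> C)
    (V : {set T}) (used : seq C) : Prop :=
  exists2 E : {set {set T}},
    [/\ E \subset edges adj, is_tree V E & {in E &, injective col}]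
    & {in E, forall e, col e \in used}.

Lemma rtree1 (T : finType) (adj : rel T) (C : eqType) (col : {set T} -> C) x :
  rtree adj col [set x] [::].
Proof.
exists set0; last by move=> e; rewrite inE.
split; [exact: sub0set | split | by move=> e; rewrite inE].
- by apply/set0Pn; exists x; rewrite set11.
- by move=> e; rewrite inE.
- by rewrite cards0 cards1.
- by move=> y z; rewrite !inE => /eqP -> /eqP ->; exact: connect0.
Qed.

(** The new edge is not in the tree because its end [v] lies outside [V]. As [used] contains every
    color of the tree, a color outside [used] keeps it rainbow. *)
Lemma rtree_leaf (T : finType) (adj : rel T) (C : eqType) (col : {set T} -> C)
    V used u v :
  rtree adj col V used -> u \in V -> v \notin V -> adj u v ->
  col [set u; v] \notin used ->
  rtree adj col (v |: V) (col [set u; v] :: used).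
Proof.
move=> [E [sE [V0 sV cE conn] injE] colE] uV vV auv fresh.
have nE : [set u; v] \notin E.
  apply: contra vV => /sV /subsetP; apply; by rewrite !inE eqxx orbT.
exists ([set u; v] |: E); last first.
  move=> e; rewrite !inE => /orP[/eqP ->|/colE ->]; first by rewrite eqxx.
  by rewrite orbT.
split.
- apply/subsetP => e; rewrite !inE => /orP[/eqP ->|eE].
    by apply/existsP; exists u; apply/existsP; exists v; rewrite auv eqxx.
  by have := subsetP sE e eE; rewrite inE.
- split.
  + by apply/set0Pn; exists v; rewrite setU11.
  + move=> e; rewrite !inE => /orP[/eqP ->|/sV eV].
      by rewrite subUset !sub1set !inE eqxx uV orbT.
    by apply: (subset_trans eV); exact: subsetUr.
  (* [V] is nonempty, so the truncated difference [#|V| - 1] really grows by one. *)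
  + rewrite !cardsU1 nE vV cE.
    by move: V0; rewrite -card_gt0; lia.
  + set r : rel T := fun x y => [set x; y] \in [set u; v] |: E.
    have rsym : connect_sym r by apply: sym_connect_sym => x y; rewrite /r setUC.
    have toU x : x \in v |: V -> connect r x u.
      rewrite !inE => /orP[/eqP ->|xV].
        by apply: connect1; rewrite /r setUC setU11.
      apply: connect_sub (conn x u xV uV) => y z yz.
      by apply: connect1; rewrite /r inE yz orbT.
    by move=> x y /toU xu /toU yu; apply: connect_trans xu _; rewrite rsym.
- move=> e f; rewrite !inE => /orP[/eqP ->|eE] /orP[/eqP ->|fE] //.
  + by move=> ef; move: fresh; rewrite ef colE.
  + by move=> ef; move: fresh; rewrite -ef colE.
  + exact: injE.
Qed.

(** * Hubs, edges and a computable criterion on color pairs *)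

Definition hub (b : bool) : 'I_2 := if b then ord_max else ord0.

Lemma hubP (h : 'I_2) : exists b, h = hub b.
Proof.
case: h => [[|[|//]] h]; [exists false | exists true]; exact: val_inj.
Qed.

Lemma hub_inj : injective hub.
Proof. by move=> [] []. Qed.

Notation vertex t := ('I_2 + 'I_t)%type.

Definition edge t (b : bool) (i : 'I_t) : {set vertex t} :=
  [set inl (hub b); inr i].

Lemma edge_inj t b b' (i i' : 'I_t) : edge b i = edge b' i' -> (b, i) = (b', i').
Proof.
move=> eE.
have : inl (hub b) \in edge b' i' by rewrite -eE !inE eqxx.
have : inr i \in edge b' i' by rewrite -eE !inE eqxx orbT.
by rewrite !inE /= orbF => /eqP[->] /eqP[/hub_inj ->].
Qed.

(** A color pair lists the color of the edge to hub [false] first, then that of the edge to hub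
    [true]. *)
Definition pk (b : bool) (p : nat * nat) := if b then p.2 else p.1.

(* Can the right vertices with color pairs [s] be attached one by one as leaves
   to the hubs in [H], with fresh colors throughout? *)
Fixpoint attachable (H : seq bool) (used : seq nat) (s : seq (nat * nat)) :=
  if s is p :: s' then
    has (fun b => (pk b p \notin used) && attachable H (pk b p :: used) s') H
  else true.

Definition star b s := attachable [:: b] [::] s.

Definition double_star (w : nat * nat) s :=
  (w.1 != w.2) && attachable [:: false; true] [:: w.2; w.1] s.

(** These are the shapes of a tree with no right vertices besides the three: either a star at one
    hub, or both hubs are present and four edges on five vertices force exactly one of the three to
    have degree two. *)
Definition tri_in p q r :=
  [|| star false [:: p; q; r], star true [:: p; q; r],
      double_star p [:: q; r], double_star q [:: p; r] | double_star r [:: p; q]].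

(** A fourth right vertex [w] may serve to join the two hubs. *)
Definition tri (L : seq (nat * nat)) p q r :=
  tri_in p q r
  || has (fun w => (w \notin [:: p; q; r]) && double_star w [:: p; q; r]) L.

(** The first two conditions settle the triples containing a hub, the last one the triples of right
    vertices. *)
Definition good (L : seq (nat * nat)) :=
  [&& uniq L, all (fun p => p.1 != p.2) L &
   all (fun p => all (fun q => all (fun r =>
     uniq [:: p; q; r] ==> tri L p q r) L) L) L].

(** The list [bs] names the hub chosen for each right vertex, which turns the search into a single
    distinctness check. *)
Lemma attachable_witness H used s bs :
  size bs = size s -> all (mem H) bs ->
  uniq ([seq pk z.1 z.2 | z <- zip bs s] ++ used) -> attachable H used s.
Proof.
elim: s bs used => [|p s IH] [|b bs] used //= [sz] /andP[bH bsH] /andP[].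
rewrite mem_cat negb_or => /andP[n1 n2] u.
apply/hasP; exists b => //; rewrite n2 /=.
apply: (IH bs) => //.
by rewrite -cat1s uniq_catCA /= mem_cat negb_or n1 n2.
Qed.

(** * From the criterion to rainbow trees *)

Definition covered t (col : {set vertex t} -> nat)
    (xs : seq (vertex t)) :=
  exists V used, rtree (K2t_adj t) col V used /\ {subset xs <= V}.

Lemma covered_sub t (col : {set vertex t} -> nat) xs ys :
  {subset xs <= ys} -> covered col ys -> covered col xs.
Proof. by move=> sub [V [used [r sV]]]; exists V, used; split=> // x /sub /sV. Qed.

Section Cover.
Variables (t : nat) (col : {set vertex t} -> nat).
Variable c : 'I_t -> nat * nat.
Hypothesis colE : forall b i, col (edge b i) = pk b (c i).

Lemma attach_covered H V used (s : seq 'I_t) :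
  rtree (K2t_adj t) col V used ->
  {in H, forall b, inl (hub b) \in V} -> {in s, forall i, inr i \notin V} ->
  uniq s -> attachable H used (map c s) ->
  exists V' used', [/\ rtree (K2t_adj t) col V' used', V \subset V'
    & {in s, forall i, inr i \in V'}].
Proof.
elim: s V used => [|i s IH] V used r HV sV /=; first by exists V, used; split.
move=> /andP[ni us] /hasP[b bH /andP[fresh att]].
have r' : rtree (K2t_adj t) col (inr i |: V) (pk b (c i) :: used).
  rewrite -colE; apply: rtree_leaf => //; first exact: HV.
    by apply: sV; rewrite mem_head.
  by rewrite -/(edge b i) colE.
have [||V' [used' [rV' sub mem]]] := IH _ _ r' _ _ us att.
- by move=> b' /HV; rewrite !inE.
- move=> j js; rewrite !inE negb_or sV ?inE ?js ?orbT // andbT.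
  by apply: contra ni => /eqP[<-].
exists V', used'; split=> //.
  by apply: subset_trans sub; exact: subsetUr.
move=> j; rewrite inE => /orP[/eqP ->|/mem //].
by apply: (subsetP sub); rewrite setU11.
Qed.

Lemma star_covered b (s : seq 'I_t) :
  uniq s -> star b (map c s) -> covered col (inl (hub b) :: map inr s).
Proof.
move=> us st.
have [||V [used [r sub mem]]] :=
  attach_covered (rtree1 (K2t_adj t) col (inl (hub b))) _ _ us st.
- by move=> b'; rewrite !inE => /eqP ->.
- by move=> i _; rewrite inE.
exists V, used; split=> // x; rewrite inE => /orP[/eqP ->|/mapP[i /mem iV ->] //].
by apply: (subsetP sub); rewrite set11.
Qed.

Lemma double_covered w (s : seq 'I_t) :
  uniq (w :: s) -> double_star (c w) (map c s) ->
  covered col [:: inl (hub false), inl (hub true) & map inr (w :: s)].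
Proof.
move=> /= /andP[nw us] /andP[w12 att].
have r0 := rtree1 (K2t_adj t) col (inl (hub false)).
have r1 : rtree (K2t_adj t) col (inr w |: [set inl (hub false)]) [:: (c w).1].
  rewrite -[(c w).1]/(pk false (c w)) -colE.
  by apply: (rtree_leaf r0); rewrite ?inE.
have r2 : rtree (K2t_adj t) col (inl (hub true) |: (inr w |: [set inl (hub false)]))
    [:: (c w).2; (c w).1].
  rewrite -[(c w).2]/(pk true (c w)) -colE /edge [[set inl _; _]]setUC.
  apply: (rtree_leaf r1) => //.
  - by rewrite !inE eqxx.
  - by rewrite !inE.
  - by rewrite setUC -/(edge true w) colE inE eq_sym.
have [||V [used [r sub mem]]] := attach_covered r2 _ _ us att.
- by move=> [] _; rewrite !inE eqxx ?orbT.
- move=> i si; rewrite !inE /= orbF; apply: contra nw => /eqP[<-] //.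
exists V, used; split=> // x.
rewrite !inE => /or4P[/eqP ->|/eqP ->|/eqP ->|/mapP[i /mem iV ->] //];
  by apply: (subsetP sub); rewrite !inE eqxx ?orbT.
Qed.

Hypothesis c_inj : injective c.
Hypothesis c_irr : forall i, (c i).1 != (c i).2.

Lemma pair_covered b i j : i != j -> covered col [:: inl (hub b); inr i; inr j].
Proof.
move=> ij.
have nij : c i != c j by apply: contra ij => /eqP/c_inj ->.
(* Different colors at hub [b] give a star. If they agree, [i] joins both hubs and [j] hangs from
   the other hub: its color there differs from that of [i] by [c_inj], and from the shared color by
   [c_irr]. *)
have [e|ne] := eqVneq (pk b (c i)) (pk b (c j)).
  have /(double_covered) : uniq [:: i; j] by rewrite /= inE ij.
  move/(_ _)/covered_sub; apply.
    by move=> x; rewrite !inE; case: (b) => /or3P[] -> ; rewrite ?orbT.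
  move: e nij (c_irr i) (c_irr j); rewrite /double_star /=.
  case: (c i) (c j) => [p1 p2] [q1 q2]; rewrite xpair_eqE /= !inE.
  by case: b => /= ->; rewrite eqxx ?andbT //= => n1 n2 n3;
    rewrite n2 /= !negb_or ?n1 ?n3 ?(eq_sym q1) ?(eq_sym q2) ?n1 ?n2 ?n3 ?orbT.
apply: covered_sub (@star_covered b [:: i; j] _ _) => //=; first by rewrite inE ij.
by rewrite /star /= !orbF inE eq_sym ne.
Qed.

Lemma tri_covered L i j l :
  (forall p, p \in L -> exists w, p = c w) -> uniq [:: i; j; l] ->
  tri L (c i) (c j) (c l) -> covered col [:: inr i; inr j; inr l].
Proof.
move=> Lc u; have u' := u; move: u'.
rewrite /= !inE !negb_or !andbT => /andP[/andP[ij il] jl].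
have sw x s : star x (map c s) -> uniq s -> covered col (map inr s).
  by move=> st us; apply: covered_sub (star_covered us st) => y ys; rewrite inE ys orbT.
have dw w s : double_star (c w) (map c s) -> uniq (w :: s) -> covered col (map inr (w :: s)).
  by move=> st us; apply: covered_sub (double_covered us st) => y ys; rewrite 2!inE ys !orbT.
case/orP=> [/or4P[|||/orP[]]|/hasP[w /Lc[v ->] /andP[nv]]].
- by move/(sw false [:: i; j; l]); exact.
- by move/(sw true [:: i; j; l]); exact.
- by move/(dw i [:: j; l]); exact.
- move/(dw j [:: i; l])/(_ _)/covered_sub; apply.
    by move=> y; rewrite !inE => /or3P[] ->; rewrite ?orbT.
  by rewrite /= !inE negb_or eq_sym ij jl il.
- move/(dw l [:: i; j])/(_ _)/covered_sub; apply.
    by move=> y; rewrite !inE => /or3P[] ->; rewrite ?orbT.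
  by rewrite /= !inE negb_or ij !(eq_sym l) jl il.
- move/(dw v [:: i; j; l])/(_ _)/covered_sub; apply.
    by move=> y yi; rewrite inE yi orbT.
  (* The pair of [v] differs from the other three, so [v] is a fourth vertex. *)
  rewrite cons_uniq u andbT; apply: contra nv.
  by rewrite !inE => /or3P[] /eqP ->; rewrite eqxx ?orbT.
Qed.

Lemma all_covered (L : seq (nat * nat)) x y z :
  L =i codom c ->
  all (fun p => all (fun q => all (fun r =>
     uniq [:: p; q; r] ==> tri L p q r) L) L) L ->
  uniq [:: x; y; z] -> covered col [:: x; y; z].
Proof.
move=> Lc Lall.
have C1 b b' (i : 'I_t) x' : x' \in [:: inl (hub b); inl (hub b'); inr i] ->
    x' \in [:: inl (hub false), inl (hub true) & map inr [:: i]].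
  by rewrite !inE; case: b b' => [] [] /or3P[] ->; rewrite ?orbT.
(* The path through [i] covers every triple with two hubs. *)
have C2 i : covered col [:: inl (hub false), inl (hub true) & map inr [:: i]].
  by apply: double_covered; rewrite //= /double_star c_irr.
case: x y z => [h|i] [h'|j] [h''|l].
- by case: (hubP h) (hubP h') (hubP h'') => [[] ->] [[] ->] [[] ->].
- move=> _; case: (hubP h) (hubP h') => [b ->] [b' ->].
  by apply: covered_sub (C2 l) => x /C1.
- move=> _; case: (hubP h) (hubP h'') => [b ->] [b' ->].
  apply: covered_sub (C2 j) => x xs; apply: (C1 b b'); move: xs.
  by rewrite !inE => /or3P[] ->; rewrite ?orbT.
- case: (hubP h) => [b ->] /and3P[_]; rewrite inE => jl _.
  exact: pair_covered.
- move=> _; case: (hubP h') (hubP h'') => [b ->] [b' ->].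
  apply: covered_sub (C2 i) => x xs; apply: (C1 b b'); move: xs.
  by rewrite !inE => /or3P[] ->; rewrite ?orbT.
- case: (hubP h') => [b ->] /and3P[]; rewrite !inE negb_or => /andP[_ il] _ _.
  apply: covered_sub (pair_covered b il) => x.
  by rewrite !inE => /or3P[] ->; rewrite ?orbT.
- case: (hubP h'') => [b ->] /and3P[]; rewrite !inE negb_or => /andP[ij _] _ _.
  apply: covered_sub (pair_covered b ij) => x.
  by rewrite !inE => /or3P[] ->; rewrite ?orbT.
- move=> u; have {}u : uniq [:: i; j; l].
    by move: u; rewrite -[[:: inr i; _; _]]/(map inr [:: i; j; l]) map_inj_uniq // => ? ? [].
  apply: (tri_covered _ u (L := L)).
    by move=> p; rewrite Lc => /codomP.
  have inL k : c k \in L by rewrite Lc codom_f.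
  move/allP: Lall => /(_ _ (inL i)) /allP/(_ _ (inL j)) /allP/(_ _ (inL l)).
  by rewrite -[[:: c i; _; _]]/(map c [:: i; j; l]) map_inj_uniq // u.
Qed.

End Cover.

Lemma good_rainbow t n (L : seq (nat * nat)) :
  0 < t -> size L = t -> all (fun p => (p.1 < n) && (p.2 < n)) L -> good L ->
  exists col : {set vertex t} -> 'I_n,
    k_rainbow_coloring (K2t_adj t) 3 col.
Proof.
move=> t0 szL Ln /and3P[uL irrL triL].
pose c (i : 'I_t) := nth (0, 0) L i.
(* An edge reads its color from the pair of its right end; 0 is a default for sets without a right
   vertex, which are not edges. *)
pose colN (e : {set vertex t}) : nat :=
  if [pick i | inr i \in e] is Some i then pk (inl (hub true) \in e) (c i) else 0.
have cL i : c i \in L by rewrite mem_nth // szL.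
have n0 : 0 < n.
  by have /(allP Ln)/andP[+ _] := cL (Ordinal t0); case: (n).
have colN_lt e : colN e < n.
  rewrite /colN; case: pickP => // i _.
  by have /(allP Ln)/andP[? ?] := cL i; rewrite /pk; case: ifP.
have colE b i : colN (edge b i) = pk b (c i).
  rewrite /colN; case: pickP => [j|/(_ i)]; last by rewrite !inE eqxx.
  by rewrite !inE /= => /eqP[->]; rewrite orbF; case: b.
have c_inj : injective c.
  by move=> i j /eqP; rewrite nth_uniq ?szL // => /eqP/val_inj.
have Lc : L =i codom c.
  move=> p; apply/idP/codomP => [/(nthP (0, 0))[m]|[i ->] //].
  by rewrite szL => mt <-; exists (Ordinal mt).
case: n n0 colN_lt {Ln} => // n _ colN_lt.
exists (fun e => inord (colN e)) => S S3.
have /card_gt2P[x [y [z [[xS yS zS] [xy yz zx]]]]] : 2 < #|S| by rewrite S3.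
have u : uniq [:: x; y; z] by rewrite /= !inE negb_or xy yz eq_sym zx.
have [V [used [[E [sE tE iE] _] sV]]] :=
  all_covered colE c_inj (fun i => allP irrL _ (cL i)) Lc triL u.
exists V, E; split=> //; last first.
  move=> e f eE fE /(congr1 val) /=; rewrite !inordK //; exact: iE.
have xyzS : [:: x; y; z] \subset S.
  by apply/subsetP => v; rewrite !inE => /or3P[] /eqP ->.
apply/subsetP => v; have /subset_leqif_card/leqifP := xyzS.
rewrite S3 (card_uniqP u) ltnn; case: ifP => // sub _ /(subsetP sub); exact: sV.
Qed.

(** * Distinct representatives of color pairs *)

Lemma pk_neq p x : p.1 != p.2 -> exists b, pk b p != x.
Proof.
have [<- |] := eqVneq p.1 x; last by exists false.
by exists true; rewrite eq_sym.
Qed.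

(** If [p] or [q] has a color outside [r], fix it; the other pair then avoids that color, and [r]
    avoids the color chosen last. Otherwise [p] and [q] both use exactly the colors of [r], so both
    are [r] swapped, against [p != q]. *)
Lemma sdr3 p q r : p.1 != p.2 -> q.1 != q.2 -> r.1 != r.2 ->
  uniq [:: p; q; r] ->
  exists a b c, uniq [:: pk a p; pk b q; pk c r].
Proof.
move=> np nq nr u.
have out s s' a : s'.1 != s'.2 -> pk a s \notin [:: r.1; r.2] ->
    exists b c, uniq [:: pk a s; pk b s'; pk c r].
  move=> ns' sr; have [b nb] := pk_neq (pk a s) ns'.
  have [c nc] := pk_neq (pk b s') nr.
  exists b, c; rewrite /= !inE negb_or !(eq_sym _ (pk _ r)) nc eq_sym nb !andbT /=.
  by apply: contra sr; rewrite !inE; case: (c) => /eqP <-; rewrite eqxx ?orbT.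
have [/(out p q _ nq)[b [c H]]|p1] := boolP (pk false p \notin [:: r.1; r.2]).
  by exists false, b, c.
have [/(out p q _ nq)[b [c H]]|p2] := boolP (pk true p \notin [:: r.1; r.2]).
  by exists true, b, c.
have [/(out q p _ np)[b [c H]]|q1] := boolP (pk false q \notin [:: r.1; r.2]).
  exists b, false, c; move: H; rewrite /= !inE !negb_or (eq_sym (q.1)).
  by case/andP=> /andP[-> ->] /andP[-> _].
have [/(out q p _ np)[b [c H]]|q2] := boolP (pk true q \notin [:: r.1; r.2]).
  exists b, true, c; move: H; rewrite /= !inE !negb_or (eq_sym (q.2)).
  by case/andP=> /andP[-> ->] /andP[-> _].
have swapped s : s.1 != s.2 -> s != r -> ~~ (pk false s \notin [:: r.1; r.2]) ->
    ~~ (pk true s \notin [:: r.1; r.2]) -> s = (r.2, r.1).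
  case: s (r) => [s1 s2] [r1 r2] /=; rewrite !inE !negbK xpair_eqE.
  by move=> ns nsr /orP[] /eqP e1 /orP[] /eqP e2; move: ns nsr; rewrite e1 e2 ?eqxx.
move: u; rewrite /= !inE negb_or !andbT => /andP[/andP[pq pr] qr].
by move: pq; rewrite (swapped p) // (swapped q) // eqxx.
Qed.

(* Two colors outside a system of distinct representatives of the three pairs
   form the color pair of a vertex which can join both hubs. *)
Lemma good_of_all_pairs k L : 4 < k -> uniq L -> all (fun p => p.1 != p.2) L ->
  (forall i j, i < j < k -> ((i, j) \in L) || ((j, i) \in L)) -> good L.
Proof.
move=> k5 uL irr cov; apply/and3P; split=> //.
apply/allP => p pL; apply/allP => q qL; apply/allP => r rL; apply/implyP => u.
have [a [b [c abc]]] :=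
  sdr3 (allP irr _ pL) (allP irr _ qL) (allP irr _ rL) u.
move: abc; set x := pk a p; set y := pk b q; set z := pk c r => abc.
have [i [j [ij ni nj]]] :
    exists i j, [/\ i < j < k, i \notin [:: x; y; z] & j \notin [:: x; y; z]].
  (* Of the five colors below 5, the representatives occupy at most three, so two remain free. *)
  pose m := [seq i <- iota 0 5 | i \notin [:: x; y; z]].
  have sm : 1 < size m.
    have := count_predC (mem [:: x; y; z]) (iota 0 5).
    rewrite -size_filter size_iota -size_filter -/m.
    have /= : size (filter (mem [:: x; y; z]) (iota 0 5)) <= size [:: x; y; z].
      apply: uniq_leq_size; first exact: filter_uniq (iota_uniq 0 5).
      by move=> v; rewrite mem_filter => /andP[].
    by clear; lia.
  have srt : sorted ltn m by apply: sorted_filter (iota_ltn_sorted 0 5) => ? ? ?; exact: ltn_trans.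
  have mP i : i \in m -> i < k /\ i \notin [:: x; y; z].
    by rewrite mem_filter mem_iota => /andP[? ?]; split=> //; lia.
  case: m sm srt mP => [|i [|j m]] // _ /andP[ij _] mP.
  have [_ ni] := mP i (mem_head _ _).
  have [jk nj] : j < k /\ j \notin [:: x; y; z] by apply: mP; rewrite !inE eqxx orbT.
  by exists i, j; split=> //; apply/andP; split.
have dbl w : (w == (i, j)) || (w == (j, i)) -> w \in L -> tri L p q r.
  move=> ww wL; apply/orP; right; apply/hasP; exists w => //.
  have wE s : s \in [:: x; y; z] -> (s != w.1) && (s != w.2).
    move=> sxyz; have /memPn/(_ s sxyz) si := ni; have /memPn/(_ s sxyz) sj := nj.
    by case/orP: ww => /eqP -> /=; rewrite si sj.
  have w12 : w.1 != w.2.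
    by case/andP: ij => ij _; case/orP: ww => /eqP -> /=; rewrite neq_ltn ij ?orbT.
  apply/andP; split.
    (* Each of [p], [q], [r] carries one of [x], [y], [z], and [w] avoids all of these. *)
    rewrite !inE; apply/negP => /or3P[] /eqP wq.
    - by have := wE x; rewrite !inE eqxx wq /x /pk; case: (a); rewrite eqxx ?andbF => /(_ isT).
    - by have := wE y; rewrite !inE eqxx orbT wq /y /pk; case: (b); rewrite eqxx ?andbF => /(_ isT).
    - by have := wE z; rewrite !inE eqxx !orbT wq /z /pk; case: (c); rewrite eqxx ?andbF => /(_ isT).
  apply/andP; split=> //; apply: (attachable_witness (bs := [:: a; b; c])) => //.
    by case: (a) (b) (c) => [] [] [].
  have nw1 : w.1 \notin [:: x; y; z] by apply/negP => /wE; rewrite eqxx.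
  have nw2 : w.2 \notin [:: x; y; z] by apply/negP => /wE; rewrite eqxx andbF.
  rewrite -[X in uniq X]/([:: x; y; z] ++ [:: w.2; w.1]) cat_uniq abc.
  by rewrite [has _ _]/= orbF negb_or nw1 nw2 /= inE eq_sym w12.
case/orP: (cov i j ij) => /dbl; apply; by rewrite eqxx ?orbT.
Qed.

(** * Explicit colorings *)

Definition pairs k := [seq (i, j) | j <- iota 0 k, i <- iota 0 j].

Definition swap (p : nat * nat) := (p.2, p.1).

(** The increasing pairs come first, so any prefix of length at least ['C(k, 2)] realizes every
    2-set of colors. *)
Definition all_pairs k := pairs k ++ map swap (pairs k).

Lemma mem_pairs k i j : ((i, j) \in pairs k) = (i < j < k).
Proof.
apply/allpairsPdep/idP => [[j' [i' []]]|ijk].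
  by rewrite !mem_iota => ? ? [-> ->]; lia.
by exists j, i; rewrite !mem_iota; split=> //; lia.
Qed.

Lemma pairs_uniq k : uniq (pairs k).
Proof.
apply: allpairs_uniq_dep => [|j _|]; rewrite ?iota_uniq //.
by move=> [x1 x2] [y1 y2] _ _ /= [-> ->].
Qed.

Lemma swapK : involutive swap. Proof. by case. Qed.

Lemma mem_swap_pairs k i j : ((i, j) \in map swap (pairs k)) = (j < i < k).
Proof. by rewrite -[(i, j)]swapK mem_map ?mem_pairs //; exact: can_inj swapK. Qed.

Lemma size_pairs k : size (pairs k) = 'C(k, 2).
Proof.
rewrite size_allpairs_dep sumnE big_map -bin2_sum /index_iota subn0.
by apply: eq_bigr => i _; rewrite size_iota.
Qed.

Lemma all_pairs_coloring k t : 4 < k -> 'C(k, 2) <= t <= k * k.-1 ->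
  exists col : {set vertex t} -> 'I_k,
    k_rainbow_coloring (K2t_adj t) 3 col.
Proof.
move=> k5 /andP[t1 t2].
have sz : size (all_pairs k) = k * k.-1.
  by rewrite size_cat size_map size_pairs addnn -mul2n bin2 mul2n halfK;
     rewrite oddM; case: (k) => // ? /=; rewrite andNb subn0.
have inL p : p \in take t (all_pairs k) -> (p.1 != p.2) && ((p.1 < k) && (p.2 < k)).
  case: p => i j /mem_take; rewrite mem_cat mem_pairs mem_swap_pairs /=; lia.
apply: (good_rainbow (L := take t (all_pairs k))).
- by apply: leq_trans t1; rewrite bin_gt0; lia.
- by rewrite size_takel // sz.
- by apply/allP => p /inL /andP[].
apply: (good_of_all_pairs k5).
- rewrite take_uniq // cat_uniq pairs_uniq map_inj_uniq ?pairs_uniq ?andbT //;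
    last exact: can_inj swapK.
  by apply/hasPn => -[i j]; rewrite mem_swap_pairs mem_pairs; lia.
- by apply/allP => p /inL /andP[].
move=> i j ij; apply/orP; left.
rewrite take_cat size_pairs ltnNge t1 /= mem_cat mem_pairs ij //.
Qed.

(** One list serves a whole range of [t], by computation. Each prefix is tested separately because
    [tri] may join the hubs by a vertex that a shorter prefix lacks. *)
Lemma prefix_coloring n (L : seq (nat * nat)) a b t :
  all (fun s => [&& 0 < s <= size L, good (take s L) &
    all (fun p => (p.1 < n) && (p.2 < n)) (take s L)]) (index_iota a b.+1) ->
  a <= t <= b ->
  exists col : {set vertex t} -> 'I_n,
    k_rainbow_coloring (K2t_adj t) 3 col.
Proof.
move=> /allP ok ab.
have /ok/and3P[/andP[t0 tL] gL Ln] : t \in index_iota a b.+1 by rewrite mem_index_iota ltnS.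
by apply: good_rainbow Ln gL => //; rewrite size_takel.
Qed.

Lemma coloring2 t : 1 <= t <= 2 ->
  exists col : {set vertex t} -> 'I_2,
    k_rainbow_coloring (K2t_adj t) 3 col.
Proof. exact: (prefix_coloring (L := [:: (0, 1); (1, 0)])). Qed.

Lemma coloring3 t : 3 <= t <= 4 ->
  exists col : {set vertex t} -> 'I_3,
    k_rainbow_coloring (K2t_adj t) 3 col.
Proof. exact: (prefix_coloring (L := [:: (0, 1); (1, 0); (1, 2); (2, 1)])). Qed.

Lemma coloring4 t : 5 <= t <= 8 ->
  exists col : {set vertex t} -> 'I_4,
    k_rainbow_coloring (K2t_adj t) 3 col.
Proof.
(* These are both orders of each edge of the 4-cycle 0, 1, 3, 2 on the colors. *)
exact: (prefix_coloring (L :=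
  [:: (0, 1); (0, 2); (1, 0); (1, 3); (2, 0); (2, 3); (3, 1); (3, 2)])).
Qed.

Lemma coloring5 t : 9 <= t <= 20 ->
  exists col : {set vertex t} -> 'I_5,
    k_rainbow_coloring (K2t_adj t) 3 col.
Proof.
have [t9 /andP[t9' _]|t9 /andP[_ t20]] := leqP t 9; last by apply: all_pairs_coloring; rewrite ?t9.
(* [t = 9] is one short of ['C(5, 2)]; the list realizes once each 2-set of colors except {3, 4}. *)
apply: (prefix_coloring (a := 9) (b := 9) (L := [:: (0, 1); (2, 0); (1, 2);
  (0, 3); (1, 3); (2, 3); (0, 4); (1, 4); (2, 4)])) => //.
by rewrite t9' t9.
Qed.

(** * Counting bound on the right part *)

Lemma mem_edges t (e : {set vertex t}) :
  e \in edges (K2t_adj t) -> exists b i, e = edge b i.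
Proof.
rewrite inE => /existsP[x /existsP[y /andP[]]].
case: x y => [h|i] [h'|j] // _ /eqP ->.
  by case: (hubP h) => b ->; exists b, j.
by case: (hubP h') => b ->; exists b, i; rewrite setUC.
Qed.

Lemma incident_edge t V (E : {set {set vertex t}}) (i : 'I_t) :
  E \subset edges (K2t_adj t) -> is_tree V E -> inr i \in V -> 1 < #|V| ->
  exists b, edge b i \in E.
Proof.
move=> sE [_ _ _ conn] iV /card_gt1P[y [z [yV zV yz]]].
have [w wV wi] : exists2 w, w \in V & w != inr i.
  have [yi|] := eqVneq y (inr i); last by exists y.
  by exists z => //; rewrite -yi eq_sym.
have /connectP[[|u p] /=] := conn _ _ iV wV; first by move=> _ wE; rewrite wE eqxx in wi.
case/andP=> iuE _ _; have [b [j e]] := mem_edges (subsetP sE _ iuE).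
have : inr i \in edge b j by rewrite -e !inE eqxx.
by rewrite !inE => /eqP[ij]; exists b; rewrite ij -e.
Qed.

Section UpperBound.
Variables (t n : nat) (col : {set vertex t} -> 'I_n).
Hypothesis colP : k_rainbow_coloring (K2t_adj t) 3 col.

(** An edge has only one right end, so the edges chosen at three right vertices are distinct, and a
    rainbow tree gives them distinct colors. *)
Lemma triple_tree (i j l : 'I_t) : uniq [:: i; j; l] ->
  exists (V : {set vertex t}) (E : {set {set vertex t}}) bi bj bl,
    [/\ E \subset edges (K2t_adj t), is_tree V E & {in E &, injective col}] /\
    [/\ [set inr i; inr j; inr l] \subset V,
        [:: edge bi i; edge bj j; edge bl l] \subset E
      & uniq [:: col (edge bi i); col (edge bj j); col (edge bl l)]].
Proof.
move=> u; have card3 : #|[set inr i; inr j; inr l] : {set vertex t}| = 3.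
  move: u; rewrite /= !inE negb_or => /and3P[/andP[ij il] jl _].
  by rewrite setUC cardsU1 cards2 !inE negb_or !(inj_eq inr_inj) !(eq_sym l) il jl ij.
have [V [E [sV sE tE iE]]] := colP card3.
have V1 : 1 < #|V| by have := subset_leq_card sV; rewrite card3; lia.
have inV x : x \in [:: i; j; l] -> inr x \in V.
  by rewrite !inE => /or3P[] /eqP ->; apply: (subsetP sV); rewrite !inE eqxx ?orbT.
have inc x (xs : x \in [:: i; j; l]) := incident_edge sE tE (inV x xs) V1.
have [bi ei] : exists b, edge b i \in E by apply: inc; rewrite !inE eqxx.
have [bj ej] : exists b, edge b j \in E by apply: inc; rewrite !inE eqxx orbT.
have [bl el] : exists b, edge b l \in E by apply: inc; rewrite !inE eqxx !orbT.
exists V, E, bi, bj, bl; split; split=> //.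
  by apply/subsetP => e; rewrite !inE => /or3P[] /eqP ->.
have neq b b' (x y : 'I_t) : edge b x \in E -> edge b' y \in E -> x != y ->
    col (edge b x) != col (edge b' y).
  by move=> xE yE; apply: contraNneq => /(iE _ _ xE yE)/edge_inj[_ ->].
move: u; rewrite /= !inE !negb_or => /and3P[/andP[ij il] jl _].
by rewrite !neq.
Qed.

Lemma right_vertices_in_two_colors (A : {set 'I_n}) : #|A| = 2 ->
  #|[set i | (col (edge false i) \in A) && (col (edge true i) \in A)]| <= 2.
Proof.
move=> A2; rewrite leqNgt; apply/negP => /card_gt2P[i [j [l [[]]]]].
rewrite !inE => iA jA lA [ij jl li].
have u : uniq [:: i; j; l] by rewrite /= !inE negb_or ij jl eq_sym li.
have [V [E [bi [bj [bl [_ [_ _ uc]]]]]]] := triple_tree u.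
have inA b x : (col (edge false x) \in A) && (col (edge true x) \in A) -> col (edge b x) \in A.
  by case/andP; case: b.
have /subset_leq_card : [:: col (edge bi i); col (edge bj j); col (edge bl l)] \subset A.
  by apply/subsetP => x; rewrite !inE => /or3P[] /eqP ->; exact: inA.
by rewrite (card_uniqP uc) A2.
Qed.

(** A tree through both hubs and a right vertex has at least two edges. *)
Lemma card_colors_gt1 : 0 < t -> 1 < n.
Proof.
move=> t0; pose S : {set vertex t} :=
  [set inl (hub false); inl (hub true); inr (Ordinal t0)].
have S3 : #|S| = 3 by rewrite /S setUC cardsU1 cards2 !inE.
have [V [E [sV sE [_ _ cE _] iE]]] := colP S3.
have En : #|E| <= n.
  by rewrite -(card_in_imset iE) -[n in _ <= n]card_ord max_card.
have := subset_leq_card sV; move: En; rewrite S3 cE; clear; lia.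
Qed.

Lemma card_colors_gt2 : 2 < t -> 2 < n.
Proof.
move=> t2; pose o k (kt : k < t) := Ordinal kt.
have u : uniq [:: o 0 (ltnW (ltnW t2)); o 1 (ltnW t2); o 2 t2] by [].
have [V [E [bi [bj [bl [_ [_ _ uc]]]]]]] := triple_tree u.
by have := max_card (mem [:: col (edge bi (o 0 (ltnW (ltnW t2))));
  col (edge bj (o 1 (ltnW t2))); col (edge bl (o 2 t2))]);
  rewrite (card_uniqP uc) card_ord.
Qed.

Lemma right_part_bound : t <= n * n.-1.
Proof.
have [t2|t2] := leqP t 2.
  case: (posnP t) => [->//|/card_colors_gt1]; case: n => [|[|m]] // _.
  by rewrite mulnS; lia.
have n2 := card_colors_gt2 t2.
pose P (A : {set 'I_n}) i := (col (edge false i) \in A) && (col (edge true i) \in A).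
have -> : n * n.-1 = 'C(n, 2) * 2 by rewrite muln2 bin2 even_halfK // oddM; case: (n) => //= m; rewrite andNb.
have <- : #|[set A : {set 'I_n} | #|A| == 2]| = 'C(n, 2) by rewrite card_draws card_ord.
rewrite -sum_nat_const -[t in t <= _]card_ord -sum1_card.
(* Double counting of right vertices against the 2-sets of colors that contain both their colors. *)
apply: (@leq_trans (\sum_i \sum_(A in [set A : {set 'I_n} | #|A| == 2]) P A i)).
  apply: leq_sum => i _.
  have [A [A2 PA]] : exists A : {set 'I_n}, #|A| = 2 /\ P A i.
    pose x := col (edge false i); pose y := col (edge true i).
    have [xy|xy] := eqVneq x y; last first.
      by exists [set x; y]; rewrite cards2 xy /P !inE !eqxx orbT.
    (* When both edges have the same color, any second color completes the 2-set. *)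
    have /card_gt1P[a [b [_ _ ab]]] : 1 < #|'I_n| by rewrite card_ord; exact: ltnW.
    have [z zx] : exists z, z != x.
      by have [ax|] := eqVneq a x; [exists b; rewrite -ax eq_sym | exists a].
    by exists [set x; z]; rewrite cards2 eq_sym zx /P -/x -/y -xy !inE eqxx.
  by rewrite (bigD1 A) ?inE ?A2 //= PA.
rewrite exchange_big; apply: leq_sum => A; rewrite inE => /eqP/right_vertices_in_two_colors.
by rewrite -sum1_card big_mkcond; apply: leq_trans; apply: leq_sum => i _; rewrite inE /P; case: ifP.
Qed.

(** * Covered triples with at most four colors *)

Let c i : nat * nat := (val (col (edge false i)), val (col (edge true i))).

(** Three incident edges at the same hub form a star. Otherwise both hubs are in the tree, which has
    at most four edges and hence no further vertex; its fourth edge gives one of the three right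
    vertices degree two. *)
Lemma tri_in_of_coloring i j l : n <= 4 -> uniq [:: i; j; l] ->
  tri_in (c i) (c j) (c l).
Proof.
move=> n4 u; have [V [E [bi [bj [bl [[sE tE iE] [sV eE uc]]]]]]] := triple_tree u.
have pkE b x : pk b (c x) = val (col (edge b x)) by case: b.
have star_in b : bi = b -> bj = b -> bl = b -> star b [:: c i; c j; c l].
  move=> bE1 bE2 bE3; apply: (attachable_witness (bs := [:: b; b; b])) => //.
    by rewrite /= inE eqxx.
  have : uniq (map val [:: col (edge b i); col (edge b j); col (edge b l)]).
    by rewrite map_inj_uniq; [rewrite -{1}bE1 -{1}bE2 -{1}bE3 | exact: val_inj].
  by rewrite /= !pkE.
have [/andP[/eqP bij /eqP bil]|ne] := boolP ((bi == bj) && (bi == bl)).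
  by rewrite /tri_in; case: (bi) (star_in bi) bij bil => st bij bil; rewrite st ?orbT.
have [eiE ejE elE] : [/\ edge bi i \in E, edge bj j \in E & edge bl l \in E].
  by split; apply: (subsetP eE); rewrite !inE eqxx ?orbT.
have eV b x : edge b x \in E -> (inl (hub b) \in V) && (inr x \in V).
  by case: tE => _ EV _ _ /EV/subsetP bxV; rewrite !bxV ?inE ?eqxx ?orbT.
have hubV b : inl (hub b) \in V.
  move: ne (eV _ _ eiE) (eV _ _ ejE) (eV _ _ elE).
  by case: bi bj bl b {eiE ejE elE eE uc star_in} => [] [] [] [] //= _ /andP[? _] /andP[? _] /andP[? _].
have double_in x y z b b' : uniq [:: x; y; z] -> edge false x \in E -> edge true x \in E ->
    edge b y \in E -> edge b' z \in E -> double_star (c x) [:: c y; c z].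
  rewrite /= !inE negb_or => /and3P[/andP[xy xz] yz _] xf xt yE zE.
  pose es := [:: edge b y; edge b' z; edge true x; edge false x].
  have esE : {subset es <= E} by move=> e; rewrite !inE => /or4P[] /eqP ->.
  have ues : uniq es.
    rewrite /= !inE !negb_or; apply/and4P; split=> //; first (apply/and3P; split).
    - by apply: contraNneq yz => /edge_inj[_ ->].
    - by apply: contraNneq xy => /edge_inj[_ ->].
    - by apply: contraNneq xy => /edge_inj[_ ->].
    - by apply/andP; split; apply: contraNneq xz => /edge_inj[_ ->].
    - by apply/eqP => /edge_inj[].
  have ucol : uniq (map (val \o col) es).
    rewrite map_inj_in_uniq // => e f /esE eE' /esE fE /val_inj; exact: iE.
  apply/andP; split.
    by move: ucol; rewrite /= !inE => /and4P[_ _ + _]; rewrite eq_sym.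
  apply: (attachable_witness (bs := [:: b; b'])) => //.
    by case: (b) (b') => [] [].
  by move: ucol; rewrite /= !pkE.
have E4 : #|E| <= 4.
  by apply: leq_trans n4; rewrite -(card_in_imset iE) -[n in _ <= n]card_ord max_card.
pose W : seq (vertex t) := map inl [:: hub false; hub true] ++ map inr [:: i; j; l].
have uW : uniq W.
  by rewrite cat_uniq !map_inj_uniq ?u //; [exact: inr_inj | exact: inl_inj].
have WV : W \subset V.
  apply/subsetP => x; rewrite !inE => /or4P[/eqP->//|/eqP->//|/eqP->|/orP[]/eqP ->];
    by apply: (subsetP sV); rewrite !inE eqxx ?orbT.
have W5 : #|W| = 5 by rewrite (card_uniqP uW).
have VE : #|V| = #|E|.+1 by case: tE => /set0Pn[x xV] _ -> _; rewrite subn1 prednK // (cardD1 x) xV.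
have V5 : #|V| = 5.
  by apply/eqP; rewrite eqn_leq -{2}W5 subset_leq_card // VE ltnS E4.
have VW : V \subset W.
  have := subset_leqif_card WV; rewrite W5 V5 => /leqif_refl.
  exact.
(* A tree on five vertices has four edges, one more than the three already named. *)
have [e eE' ne3] : exists2 e, e \in E & e \notin [:: edge bi i; edge bj j; edge bl l].
  apply/subsetPn; apply/negP => /subset_leq_card; rewrite leqNgt => /negP; apply.
  by apply: leq_ltn_trans (card_size _) _; move: VE; rewrite V5 => -[<-].
have [b [m em]] := mem_edges (subsetP sE _ eE').
(* If [e] ends at [x], then [e] and the named edge at [x] lead to different hubs. *)
have both x b' : m = x -> edge b' x \in E -> edge b' x \in [:: edge bi i; edge bj j; edge bl l] ->
    edge false x \in E /\ edge true x \in E.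
  move=> mx b'E b'3; have bb' : b != b'.
    by apply: contraNneq ne3 => bb'; rewrite em mx bb'.
  by move: eE' b'E; rewrite em mx; case: (b) (b') bb' => [] [].
have : inr m \in W by apply: (subsetP VW); move: eE'; rewrite em => /eV/andP[].
rewrite !inE /= !(inj_eq inr_inj) => /or3P[] /eqP mE.
- have [||xf xt] := both _ bi mE => //; first by rewrite !inE eqxx.
  by rewrite /tri_in (double_in _ _ _ bj bl) ?orbT.
- have [||xf xt] := both _ bj mE => //; first by rewrite !inE eqxx orbT.
  rewrite /tri_in (double_in j i l bi bl) ?orbT //.
  by move: u; rewrite /= !inE !negb_or (eq_sym j i) => /and3P[/andP[-> ->] -> _].
- have [||xf xt] := both _ bl mE => //; first by rewrite !inE eqxx !orbT.
  rewrite /tri_in (double_in l i j bi bj) ?orbT //.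
  by move: u; rewrite /= !inE !negb_or !(eq_sym l) => /and3P[/andP[-> ->] -> _].
Qed.

End UpperBound.

(** * Exhaustive search over color pairs *)

(** Base 4 separates all pairs, as the search is run on at most four colors. *)
Definition code (p : nat * nat) := 4 * p.1 + p.2.

(* Exhaustive search for [d] more color pairs; ordering the pairs by [code], from
   [m] on, visits each multiset only once. *)
Fixpoint extends n d m l :=
  if d is d'.+1 then
    (* not [&&]: [vm_compute] would evaluate both sides and never prune *)
    has (fun p => if (m <= code p) && pairwise (fun q r => tri_in p q r) l
                  then extends n d' (code p) (p :: l) else false)
      [seq (x, y) | x <- iota 0 n, y <- iota 0 n]
  else true.

(** The search can follow the pairs of the vertices in [s], with [r] holding those already placed.
    Indexing by [I] lets distinct vertices share a color pair. *)
Lemma extends_sound n (I : eqType) (c : I -> nat * nat) :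
  (forall i, ((c i).1 < n) && ((c i).2 < n)) ->
  (forall i j l, uniq [:: i; j; l] -> tri_in (c i) (c j) (c l)) ->
  forall s r m, uniq (s ++ r) -> path leq m (map (code \o c) s) ->
    extends n (size s) m (map c r).
Proof.
move=> cn ctri; elim=> [|i s IH] //= r m /andP[ni u] /andP[mi si].
apply/hasP; exists (c i).
  by apply/allpairsP; exists (c i); rewrite !mem_iota /= !add0n -surjective_pairing;
    have /andP[-> ->] := cn i.
rewrite mi /= ifT; last first.
  move: ni u; rewrite mem_cat negb_or cat_uniq => /andP[_ nir] /and3P[_ _ ur].
  rewrite pairwise_map; move: ur nir; rewrite uniq_pairwise.
  elim: r => //= j r IHr /andP[jr /IHr rr]; rewrite inE negb_or => /andP[ij ir].
  rewrite rr // andbT; apply/allP => l lr /=; apply: ctri.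
  have jl : j != l := allP jr l lr.
  rewrite /= !inE negb_or ij jl !andbT.
  by apply: contraNneq ir => ->.
apply: (IH (i :: r)) => //.
by rewrite -[i :: r]cat1s uniq_catCA /= ni u.
Qed.

Lemma right_part_bound_search t n d (col : {set vertex t} -> 'I_n) :
  n <= 4 -> ~~ extends n d 0 [::] -> k_rainbow_coloring (K2t_adj t) 3 col ->
  t < d.
Proof.
move=> n4 nex colP; rewrite ltnNge; apply: contra nex => dt.
pose c i : nat * nat := (val (col (edge false i)), val (col (edge true i))).
(* Any [d] right vertices would violate the search; sorting by [code] puts them in the order that it
   visits. *)
pose s := take d (sort (relpre (code \o c) leq) (enum 'I_t)).
have szs : size s = d by rewrite size_takel // size_sort size_enum_ord.
rewrite -szs; apply: (@extends_sound n _ c _ _ s [::]).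
- by move=> i; rewrite !ltn_ord.
- by move=> i j l; exact: tri_in_of_coloring.
- by rewrite cats0 take_uniq // sort_uniq enum_uniq.
have : sorted leq (map (code \o c) s).
  rewrite sorted_map; apply: take_sorted; apply: sort_sorted => x y; exact: leq_total.
by case: (map _ s).
Qed.

(** * The rainbow index *)

Lemma rainbow_coloring_widen t m n (col : {set vertex t} -> 'I_m) :
  m <= n -> k_rainbow_coloring (K2t_adj t) 3 col ->
  exists col' : {set vertex t} -> 'I_n,
    k_rainbow_coloring (K2t_adj t) 3 col'.
Proof.
move=> mn colP; exists (fun e => widen_ord mn (col e)) => S /colP[V [E [sV sE tE iE]]].
exists V, E; split=> // e f eE fE /(congr1 val) /= /val_inj; exact: iE.
Qed.

(** A coloring with fewer colors is also one with [n] colors, so refuting exactly [n] colors is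
    enough. *)
Lemma index_lower_bound t n
    (bound : forall col : {set vertex t} -> 'I_n,
      ~ k_rainbow_coloring (K2t_adj t) 3 col)
    m (col : {set vertex t} -> 'I_m) :
  k_rainbow_coloring (K2t_adj t) 3 col -> n < m.
Proof.
move=> colP; rewrite ltnNge; apply/negP => mn.
by have [col' /bound] := rainbow_coloring_widen mn colP.
Qed.

Theorem theorem1 (t : nat) (ht : 1 <= t) :
  [/\ (t <= 2 -> rainbow_index_is (K2t_adj t) 3 2),
      (3 <= t <= 4 -> rainbow_index_is (K2t_adj t) 3 3),
      (5 <= t <= 8 -> rainbow_index_is (K2t_adj t) 3 4),
      (9 <= t <= 20 -> rainbow_index_is (K2t_adj t) 3 5)
    & (forall k, 6 <= k -> (k.-1 * k.-2).+1 <= t <= k * k.-1 ->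
         rainbow_index_is (K2t_adj t) 3 k)].
Proof.
split=> [t2|t34|t58|t920|k k6 tk]; split.
- by apply: coloring2; rewrite ht.
- by move=> m col /card_colors_gt1; exact.
- exact: coloring3.
- by move=> m col /card_colors_gt2; apply; case/andP: t34.
- exact: coloring4.
(* Counting alone allows six right vertices on three colors; the search excludes five. *)
- apply: index_lower_bound => col /(right_part_bound_search (d := 5)) t5.
  by have : t < 5 by [apply: t5; vm_compute]; rewrite ltnNge; case/andP: t58 => ->.
- exact: coloring5.
(* Counting alone allows twelve right vertices on four colors; the search excludes nine. *)
- apply: index_lower_bound => col /(right_part_bound_search (d := 9)) t9.
  by have : t < 9 by [apply: t9; vm_compute]; rewrite ltnNge; case/andP: t920 => ->.
- case/andP: tk => tk1 tk2; apply: all_pairs_coloring; first exact: ltnW.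
  (* The whole range of [t] lies above ['C(k, 2)], since [k <= 2 * (k - 2)] for these [k]. *)
  rewrite tk2 andbT (leq_trans _ tk1) // bin2 leq_half_double.
  case: k k6 {tk1 tk2} => [|[|k]] //= k6; nia.
(* With one color fewer, the counting bound stops exactly one below the range of [t]. *)
- case: k k6 tk => [|k] // _ /andP[tk _].
  by apply: index_lower_bound => col /right_part_bound; rewrite leqNgt tk.
Qed.
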